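(* Let $\gamma,\sigma>0$. For each positive integer $n$ let $Q$ be a random real symmetric $n\times n$ matrix whose diagonal entries are i.i.d. $N(0,\gamma^2)$ and whose off-diagonal entries $(Q_{ij})_{i<j}$ are i.i.d. $N(0,\sigma^2)$, all mutually independent. Let $m_n:=\min_{1\le i\le n}Q_{ii}$ and let $F_O$ be the distribution function of $N(0,\sigma^2)$. If $$\sigma^2<\frac45\,\gamma^2,$$ then $n^5\,\mathbb{E}\bigl[F_O(m_n)^4\bigr]\to0$ as $n\to\infty$.
   Context: $N(0,\sigma^2)$ denotes the normal law with mean $0$ and variance $\sigma^2$. *)

(* Defs.v *)
From HB Require Import structures.
From mathcomp Require Import all_boot all_order all_algebra.
From mathcomp Require Import all_classical all_reals all_analysis.

Set Implicit Arguments.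
Unset Strict Implicit.
Unset Printing Implicit Defensive.

Import Order.TTheory GRing.Theory Num.Theory.
Import numFieldNormedType.Exports.

Local Open Scope classical_set_scope.
Local Open Scope ring_scope.

(* Joint independence of the subfamily (X i) with i ranging over D: the product
   rule holds for every finite subfamily J of D. *)
Definition mutually_independent d (T : measurableType d) (R : realType)
    (P : probability T R) d' (T' : measurableType d') (I : finType)
    (D : {pred I}) (X : I -> {RV P >-> T'}) : Prop :=
  forall (J : {set I}) (A : I -> set T'),
    J \subset D -> (forall i, i \in J -> measurable (A i)) ->
    P (\bigcap_(i in [set` J]) (X i @^-1` A i)) =
    (\prod_(i in J) P (X i @^-1` A i))%E.

Definition has_law d (T : measurableType d) (R : realType)
    (P : probability T R) (X : {RV P >-> R}) (mu : probability (measurableTypeR R) R) : Prop :=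
  forall A : set R, measurable A -> distribution P X A = mu A.

(* A random n x n matrix is a matrix of real random variables.  The second
   parameter of normal_prob is the standard deviation, so normal_prob 0 s is
   the law N(0, s ^ 2). *)
Record gaussian_symmetric_mx d (T : measurableType d) (R : realType)
    (P : probability T R) (n : nat) (gamma sigma : R)
    (Q : 'M[{RV P >-> R}]_n) : Prop := GaussianSymmetricMx {
  gsm_sym : Q^T = Q ;
  gsm_diag : forall i, has_law (Q i i) (normal_prob 0 gamma) ;
  gsm_offdiag : forall i j : 'I_n, (i < j)%N ->
    has_law (Q i j) (normal_prob 0 sigma) ;
  gsm_indep : mutually_independent [pred ij : 'I_n * 'I_n | (ij.1 <= ij.2)%N]
    (fun ij => Q ij.1 ij.2) }.

Definition distribution_function (R : realType) (mu : probability (measurableTypeR R) R)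
  (x : R) : R := fine (mu `]-oo, x]%classic).

(* The size n.+1 makes the minimum one of a nonempty family; the seed of the
   iterated minimum is itself a diagonal entry. *)
Definition diag_min d (T : measurableType d) (R : realType)
    (P : probability T R) (n : nat) (Q : 'M[{RV P >-> R}]_n.+1) (w : T) : R :=
  \big[Num.min/Q ord0 ord0 w]_(i < n.+1) Q i i w.

(* Main.v *)
(* Fix v with 5/4 sigma^2 < v < gamma^2 and cut at -t, where t^2 = 2 v ln n.
   On m_n <= -t, F_O(m_n)^4 is at most F_O(-t)^4 <= n^(-4 v / sigma^2), which
   is o(n^-5) since v > 5/4 sigma^2.  Each diagonal entry falls below -t with
   probability at least c n^(-beta) for some beta < 1, since v < gamma^2, so
   by independence m_n > -t has probability at most
   (1 - c n^(-beta))^n <= exp(- c n^(1 - beta)), which beats every power of n. *)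

Require Import Defs.
From HB Require Import structures.
From mathcomp Require Import all_boot all_order all_algebra.
From mathcomp Require Import all_classical all_reals all_analysis.
From mathcomp Require Import measurable_realfun.
From mathcomp Require Import ring lra.

Set Implicit Arguments.
Unset Strict Implicit.
Unset Printing Implicit Defensive.

Import Order.TTheory GRing.Theory Num.Theory.
Import numFieldNormedType.Exports.

Local Open Scope classical_set_scope.
Local Open Scope ring_scope.

(** * Gaussian tail bounds *)

Lemma normal_prob_left_tail_le (R : realType) (s t : R) : 0 < s -> 0 <= t ->
  (normal_prob 0 s `]-oo, (- t)%R] <= (expR (- (t ^+ 2 / (2 * s ^+ 2))))%:E)%E.
Proof.
move=> s0 t0; set e := expR _.
have s20 : 0 < s ^+ 2 by rewrite exprn_gt0.
(* For x <= -t one has x^2 >= t^2 + (x + t)^2, so the density at x is at most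
   e times the density of the law centred at -t. *)
have le_pdf x : x <= - t -> normal_pdf 0 s x <= e * normal_pdf (- t) s x.
  move=> xt; rewrite !normal_pdfE ?gt_eqF// mulrCA ler_wpM2l ?normal_peak_ge0//.
  rewrite /normal_fun -expRD ler_expR -(mulr_natl (s ^+ 2)) -[X in _ <= X + _]mulNr -mulrDl.
  by rewrite ler_pM2r ?invr_gt0 ?mulr_gt0//; nra.
have mpdf m : measurable_fun (`]-oo, (- t)%R] : set (measurableTypeR R)) (EFin \o normal_pdf m s).
  by apply/measurable_EFinP; apply: measurable_funTS; exact: measurable_normal_pdf.
apply: (@le_trans _ _ (e%:E * normal_prob (- t) s `]-oo, (- t)%R])%E).
  rewrite /normal_prob -ge0_integralZl//=; last 3 first.
  - exact: mpdf.
  - by move=> x _; rewrite lee_fin normal_pdf_ge0.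
  - by rewrite lee_fin expR_ge0.
  apply: ge0_le_integral => //=.
  - by move=> x _; rewrite lee_fin normal_pdf_ge0.
  - exact: mpdf.
  - by apply/measurable_funeM; exact: mpdf.
rewrite -[leRHS]mule1 lee_pmul2l ?lte_fin ?expR_gt0//.
exact: probability_le1.
Qed.

(** The unit interval [[-t - 1, -t]] already carries this mass: the density on it is smallest at the
    left end. *)
Lemma normal_prob_left_tail_ge (R : realType) (s t : R) : 0 < s -> 0 <= t ->
  ((normal_peak s * expR (- ((t + 1) ^+ 2 / (2 * s ^+ 2))))%:E <=
   normal_prob 0 s `]-oo, (- t)%R])%E.
Proof.
move=> s0 t0; set c := (X in X%:E).
have s20 : 0 < s ^+ 2 by rewrite exprn_gt0.
have c0 : 0 <= c by rewrite mulr_ge0 ?normal_peak_ge0 ?expR_ge0.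
apply: (@le_trans _ _ (normal_prob 0 s `[(- t - 1)%R, (- t)%R])); last first.
  apply: le_measure; rewrite ?inE//.
  by move=> x/=; rewrite !in_itv/= => /andP[].
rewrite /normal_prob.
apply: (@le_trans _ _ (\int[lebesgue_measure]_(x in `[(- t - 1)%R, (- t)%R]) (cst c%:E) x)%E).
  rewrite integral_cst//= lebesgue_measure_itv/= lte_fin ifT; last lra.
  by rewrite -EFinB opprB addrCA subrr addr0 mule1.
apply: ge0_le_integral => //=.
- by apply/measurable_EFinP; apply: measurable_funTS; exact: measurable_normal_pdf.
move=> x; rewrite in_itv/= => /andP[x1 x2].
rewrite lee_fin normal_pdfE ?gt_eqF// ler_wpM2l ?normal_peak_ge0//.
rewrite /normal_fun ler_expR -(mulr_natl (s ^+ 2)) -mulNr.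
by rewrite ler_pM2r ?invr_gt0 ?mulr_gt0//; nra.
Qed.

(** * Decay of exponentials *)

(** The exponential series dominates its term of degree [k.+1]; take reciprocals. *)
Lemma expRN_le_invX (R : realType) (x : R) (k : nat) : 0 < x ->
  expR (- x) <= k.+1`!%:R / x ^+ k.+1.
Proof.
move=> x0; rewrite expRN -[leRHS]invf_div lef_pV2 ?posrE ?expR_gt0//; last first.
  by rewrite divr_gt0 ?exprn_gt0 ?ltr0n ?fact_gt0.
by apply: le_trans (expR_ge1Dxn k (ltW x0)); rewrite lerDr.
Qed.

Lemma cvg_expR_ln_natN (R : realType) (k : R) : 0 < k ->
  expR (- (k * ln n.+1%:R)) @[n --> \oo] --> (0 : R).
Proof.
move=> k0.
have cvgy : (k * ln n.+1%:R : R) @[n --> \oo] --> +oo.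
  apply/cvgryPge => A; near=> n.
  (* It suffices that [n.+1] exceeds [expR (A / k)]. *)
  rewrite mulrC -ler_pdivrMr// -ler_expR lnK ?posrE//.
  rewrite (le_trans (ltW (archi_boundP (expR_ge0 _))))// ler_nat leqW//.
  by near: n; exact: nbhs_infty_ge.
exact: (cvg_comp _ _ cvgy (@cvgr_expR R)).
Unshelve. all: by end_near. Qed.

(** * Distribution functions *)

Lemma distribution_function_ge0 (R : realType)
    (mu : probability (measurableTypeR R) R) x : 0 <= distribution_function mu x.
Proof. exact: fine_ge0. Qed.

Lemma distribution_function_le1 (R : realType)
    (mu : probability (measurableTypeR R) R) x : distribution_function mu x <= 1.
Proof. by rewrite -lee_fin fineK ?fin_num_measure ?probability_le1. Qed.

Lemma distribution_function_homo (R : realType)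
    (mu : probability (measurableTypeR R) R) :
  {homo distribution_function mu : x y / x <= y}.
Proof.
move=> x y xy; apply: fine_le; rewrite ?fin_num_measure//.
apply: le_measure; rewrite ?inE//.
by move=> z /=; rewrite !in_itv/= => /le_trans; apply.
Qed.

(** * The minimum of the diagonal *)

Section diag_min.
Context d (T : measurableType d) (R : realType) (P : probability T R) (n : nat).
Variable Q : 'M[{RV P >-> R}]_n.+1.

Lemma measurable_diag_min : measurable_fun setT (diag_min Q).
Proof.
rewrite /diag_min; elim: (index_enum _) => [|i s IH].
  by rewrite (_ : (fun w => _) = Q ord0 ord0) //; apply/funext => w; rewrite big_nil.
rewrite (_ : (fun w => _) = (Q i i : T -> R) \min
    (fun w => \big[Num.min/Q ord0 ord0 w]_(j <- s) Q j j w)).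
  by apply: measurable_minr => //; exact: IH.
by apply/funext => w; rewrite big_cons.
Qed.

Lemma diag_min_gt x : [set w | x < diag_min Q w] =
  \bigcap_(i in [set: 'I_n.+1]) (Q i i @^-1` `]x, +oo[).
Proof.
apply/seteqP; split=> w /=.
  by move=> /bigmin_gtP[_ h] i _ /=; rewrite in_itv/= h.
move=> h; apply/bigmin_gtP; split=> [|i _].
  by have := h ord0 I; rewrite /= in_itv/= andbT.
by have := h i I; rewrite /= in_itv/= andbT.
Qed.

(** By independence the probability is a power of the upper tail of one entry, and that tail is at
    most [1 - p <= expR (- p)]. *)
Lemma diag_min_gt_prob gamma sigma (x p : R) :
  gaussian_symmetric_mx gamma sigma Q ->
  (p%:E <= normal_prob 0 gamma `]-oo, x])%E ->
  (P [set w | (x < diag_min Q w)%R] <= (expR (- (n.+1%:R * p)))%:E)%E.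
Proof.
move=> gQ ptail; pose mu : probability (measurableTypeR R) R := normal_prob 0 gamma.
(* Independence is given for pairs on or above the diagonal, so the intersection is reindexed by the
   diagonal pairs. *)
pose J := [set (i, i) | i : 'I_n.+1]%SET.
have -> : [set w | x < diag_min Q w] =
    \bigcap_(ij in [set` J]) (Q ij.1 ij.2 @^-1` `]x, +oo[).
  rewrite diag_min_gt; apply/seteqP; split=> w h.
    by move=> _ /= /imsetP[i _ ->]; exact: (h i I).
  by move=> i _; apply: (h (i, i)); apply/imsetP; exists i.
rewrite (gsm_indep gQ (J := J) (A := fun=> `]x, +oo[%classic))//; last first.
  by apply/fintype.subsetP => _ /imsetP[i _ ->]; rewrite inE/=.
have muE : mu `]x, +oo[%classic = (1 - mu `]-oo, x]%classic)%E.
  by rewrite -(setCitvl (BRight x)) probability_setC.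
pose a := fine (mu `]x, +oo[%classic).
have aE : a%:E = mu `]x, +oo[%classic by rewrite fineK ?fin_num_measure.
have ae : a <= expR (- p).
  apply: le_trans (expR_ge1Dx _).
  by rewrite -lee_fin aE muE EFinB leeB.
rewrite (eq_bigr (fun=> a%:E)) => [|_ /imsetP[i _ ->]]; last first.
  by rewrite aE -(gsm_diag gQ i).
rewrite prodEFin prodr_const card_imset ?card_ord; last by move=> i j [].
rewrite lee_fin -mulrN expRM_natl.
by rewrite lerXn2r ?nnegrE ?expR_ge0// fine_ge0.
Qed.

(** Integrate a pointwise bound: where the minimum is at most [x], monotonicity gives the first
    term; elsewhere the integrand is at most 1, the value of the indicator. *)
Lemma expectation_diag_min_le (mu : probability (measurableTypeR R) R) (x : R) (k : nat) :
  ('E_P[fun w => (distribution_function mu (diag_min Q w) ^+ k)%R] <=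
   (distribution_function mu x ^+ k)%:E + P [set w | (x < diag_min Q w)%R])%E.
Proof.
set F := distribution_function mu.
have F0 : forall y, 0 <= F y ^+ k.
  by move=> y; rewrite exprn_ge0// distribution_function_ge0.
have mS : measurable [set w | x < diag_min Q w].
  by rewrite diag_min_gt; apply: fin_bigcap_measurable => // i _; exact: measurable_funPTI.
have mF : measurable_fun setT (fun w => F (diag_min Q w) ^+ k).
  apply: measurable_funX; apply: measurableT_comp; last exact: measurable_diag_min.
  by apply: nondecreasing_measurable => // y z; exact: distribution_function_homo.
rewrite unlock.
rewrite -[X in (_ <= _ + P X)%E]setIT -integral_indic//.
rewrite -[X in (_ <= X + _)%E]mule1 -(probability_setT P) -integral_cst//.
rewrite -ge0_integralD//=; last first.
- by apply/measurable_EFinP; exact: measurable_indic.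
- by move=> w _; rewrite lee_fin.
apply: ge0_le_integral => //=.
- by move=> w _; rewrite lee_fin.
- exact/measurable_EFinP.
- by apply/measurable_EFinP; apply: measurable_funD => //; exact: measurable_indic.
move=> w _; rewrite lee_fin indicE.
have [xw|wx] := ltP x (diag_min Q w).
  rewrite mem_set// (le_trans (_ : _ <= 1)) ?lerDr//.
  by rewrite exprn_ile1// ?distribution_function_ge0 ?distribution_function_le1.
rewrite memNset ?addr0; last by apply/negP; rewrite -leNgt.
by rewrite lerXn2r ?nnegrE ?distribution_function_ge0// distribution_function_homo.
Qed.
End diag_min.

(** * Estimates on the logarithmic scale *)

(** For [L = ln N] this bounds exp(-c N^delta) by C N^(-a). *)
Lemma expR_double_exp_le (R : realType) (c delta a : R) : 0 < c -> 0 < delta ->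
  exists C : R, forall L, 0 <= L ->
    expR (- (c * expR (delta * L))) <= C * expR (- (a * L)).
Proof.
(* The degree [k.+1] is large enough that [k.+1 * delta >= a]. *)
move=> c0 delta0; pose k := Num.bound `|a / delta|.
have ak : a <= k.+1%:R * delta.
  rewrite -ler_pdivrMr// (le_trans (ler_norm _))//.
  rewrite (le_trans (ltW (archi_boundP (normr_ge0 _))))// ler_nat; exact: leqnSn.
exists (k.+1`!%:R / c ^+ k.+1) => L L0.
have x0 : 0 < c * expR (delta * L) by rewrite mulr_gt0 ?expR_gt0.
apply: (le_trans (expRN_le_invX k x0)).
rewrite exprMn invfM mulrA ler_wpM2l//.
  by rewrite divr_ge0 ?exprn_ge0 // ltW.
rewrite -expRM_natl -expRN ler_expR lerN2 mulrA.
exact: ler_wpM2r.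
Qed.

Lemma normal_prob_left_tail_sqrt_le (R : realType) (s v L : R) :
  0 < s -> 0 <= v -> 0 <= L ->
  (normal_prob 0 s `]-oo, (- Num.sqrt (2 * v * L))%R] <=
   (expR (- (v / s ^+ 2 * L)))%:E)%E.
Proof.
move=> s0 v0 L0.
have := normal_prob_left_tail_le s0 (sqrtr_ge0 (2 * v * L)).
rewrite sqr_sqrtr ?mulr_ge0//.
suff -> : 2 * v * L / (2 * s ^+ 2) = v / s ^+ 2 * L by [].
by field; rewrite gt_eqF.
Qed.

(** The exact exponent would be [v / s ^+ 2]; the strict gap up to [beta] absorbs the shift from [t]
    to [t + 1] in the lower tail bound. *)
Lemma normal_prob_left_tail_sqrt_ge (R : realType) (s v beta : R) :
  0 < s -> 0 < v -> v < beta * s ^+ 2 ->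
  exists2 c : R, 0 < c & forall L, 0 <= L ->
    ((c * expR (- (beta * L)))%:E <=
     normal_prob 0 s `]-oo, (- Num.sqrt (2 * v * L))%R])%E.
Proof.
move=> s0 v0 vb; have s20 : 0 < s ^+ 2 by rewrite exprn_gt0.
(* The relative gap: [(1 + e) * v = beta * s ^+ 2]. *)
pose e := beta * s ^+ 2 / v - 1.
have e0 : 0 < e by rewrite subr_gt0 ltr_pdivlMr ?mul1r.
exists (normal_peak s * expR (- ((1 + e^-1) / (2 * s ^+ 2)))).
  by rewrite mulr_gt0 ?expR_gt0// normal_peak_gt0// gt_eqF.
move=> L L0; set t := Num.sqrt _.
have t0 : 0 <= t by exact: sqrtr_ge0.
have t2 : t ^+ 2 = 2 * v * L by rewrite sqr_sqrtr ?mulr_ge0// ltW.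
apply: le_trans (normal_prob_left_tail_ge s0 t0).
rewrite lee_fin -mulrA ler_wpM2l ?normal_peak_ge0// -expRD ler_expR -opprD lerN2.
have -> : beta * L = (1 + e) * t ^+ 2 / (2 * s ^+ 2).
  by rewrite t2 /e; field; rewrite !gt_eqF.
rewrite -mulrDl ler_pM2r ?invr_gt0 ?mulr_gt0//.
(* (t + 1)^2 <= (1 + e) t^2 + (1 + 1/e) *)
rewrite -subr_ge0 (_ : _ - _ = (e * t - 1) ^+ 2 / e).
  by rewrite divr_ge0 ?sqr_ge0// ltW.
by field; rewrite gt_eqF.
Qed.

(* The positive integer of the text is n.+1. *)
Theorem proposition7p1 (R : realType) (gamma sigma : R)
    (gamma_gt0 : 0 < gamma) (sigma_gt0 : 0 < sigma)
    (d : nat -> measure_display) (T : forall n, measurableType (d n))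
    (P : forall n, probability (T n) R)
    (Q : forall n, 'M[{RV (P n) >-> R}]_n.+1)
    (Q_gaussian : forall n, gaussian_symmetric_mx gamma sigma (Q n))
    (sigma_lt : sigma ^+ 2 < 4 / 5 * gamma ^+ 2) :
  ((n.+1%:R ^+ 5)%R%:E *
     'E_(P n)[fun w => (distribution_function (normal_prob 0 sigma)
                          (diag_min (Q n) w) ^+ 4)%R])%E
    @[n --> \oo] --> 0%E.
Proof.
have g20 : 0 < gamma ^+ 2 by rewrite exprn_gt0.
have s20 : 0 < sigma ^+ 2 by rewrite exprn_gt0.
(* Any v strictly between 5/4 sigma^2 and gamma^2 works. *)
pose v := (5 / 4 * sigma ^+ 2 + gamma ^+ 2) / 2.
have v0 : 0 < v by rewrite /v; lra.
(* The midpoint of [v / gamma ^+ 2] and 1 leaves room on both sides. *)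
pose beta := (v / gamma ^+ 2 + 1) / 2.
have vg : v / gamma ^+ 2 < 1 by rewrite ltr_pdivrMr// /v; lra.
have beta1 : 0 < 1 - beta by rewrite /beta; lra.
have vb : v < beta * gamma ^+ 2 by rewrite -ltr_pdivrMr// /beta; lra.
(* With N = [n.+1], N^5 times the fourth power of the tail bound N^(-v / sigma^2) is N^(-kappa). *)
pose kappa := 4 * (v / sigma ^+ 2) - 5.
have kappa0 : 0 < kappa.
  by rewrite subr_gt0 mulrA ltr_pdivlMr// /v; lra.
have [c c0 tail_ge] := normal_prob_left_tail_sqrt_ge gamma_gt0 v0 vb.
(* Exponent 6 beats the factor N^5 by one power, the second term of [h]. *)
have [C HC] := expR_double_exp_le 6 c0 beta1.
pose L n : R := ln n.+1%:R.
have L0 n : 0 <= L n by rewrite ln_ge0// ler1n.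
have LE n : expR (L n) = n.+1%:R by rewrite lnK ?posrE.
pose h n := expR (- (kappa * L n)) + C * expR (- (1 * L n)).
apply: (@squeeze_cvge _ _ _ _ (cst 0%E) _ (EFin \o h)).
- apply: nearW => n /=; apply/andP; split.
    rewrite mule_ge0 ?lee_fin ?exprn_ge0// unlock integral_ge0// => w _.
    by rewrite lee_fin exprn_ge0// distribution_function_ge0.
  pose x := - Num.sqrt (2 * v * L n).
  set F := distribution_function _.
  have Fx : F x <= expR (- (v / sigma ^+ 2 * L n)).
    rewrite -lee_fin fineK ?fin_num_measure//.
    exact: normal_prob_left_tail_sqrt_le (ltW v0) (L0 n).
  have Px := diag_min_gt_prob (Q_gaussian n) (tail_ge _ (L0 n)).
  apply: (@le_trans _ _ ((n.+1%:R ^+ 5)%:E * (F x ^+ 4 + C * expR (- (6 * L n)))%:E)%E).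
    rewrite lee_pmul2l ?lte_fin ?exprn_gt0//.
    apply: (le_trans (expectation_diag_min_le (Q n) _ x 4)).
    rewrite EFinD leeD2l//; apply: (le_trans Px); rewrite lee_fin.
    apply: le_trans (HC _ (L0 n)).
    (* The N entries turn c N^(-beta) into c N^(1 - beta). *)
    rewrite -(LE n) mulrCA -expRD.
    by rewrite [(1 - beta) * _]mulrBl mul1r.
  rewrite -EFinM lee_fin mulrDr lerD//.
    rewrite -(LE n) -expRM_natl.
    apply: (@le_trans _ _ (expR (5 * L n) * expR (- (v / sigma ^+ 2 * L n)) ^+ 4)).
      rewrite ler_wpM2l ?expR_ge0// lerXn2r ?nnegrE ?expR_ge0//.
      exact: distribution_function_ge0.
    by rewrite -expRM_natl -expRD ler_expR /kappa; lra.
  rewrite mulrCA -(LE n) -expRM_natl -expRD.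
  by have -> : 5 * L n - 6 * L n = - (1 * L n) by ring.
- exact: cvg_cst.
rewrite -[X in _ --> X]/((0 : R)%:E); apply: cvg_EFin.
  by apply: nearW.
have -> : (0 : R) = 0 + C * 0 by rewrite mulr0 addr0.
apply: cvgD; first exact: cvg_expR_ln_natN.
by apply: cvgMr; exact: cvg_expR_ln_natN.
Qed.
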